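(* Let $\Theta\subset\mathbb{R}^p$ and, for each $n$, let $Q_n:\Theta\to\mathbb{R}$ be a (random) objective function depending on data $\mathbf z_1,\dots,\mathbf z_n$ and $\tilde Q_n:\Theta\to\mathbb{R}$ a (random) approximation of it. Let $\hat{\boldsymbol\theta}_{AM}=\arg\max_{\boldsymbol\theta\in\Theta}\tilde Q_n(\boldsymbol\theta)$. Assume: (i) there exist a function $Q_0:\Theta\to\mathbb{R}$ and $\boldsymbol\theta_0\in\Theta$ such that $Q_0$ is uniquely maximized at $\boldsymbol\theta_0$, $\Theta$ is compact, $Q_0$ is continuous, and $\sup_{\boldsymbol\theta\in\Theta}|Q_n(\boldsymbol\theta)-Q_0(\boldsymbol\theta)|\to0$ in probability; moreover $\boldsymbol\theta_0$ lies in the interior of $\Theta$; $Q_n$ is twice continuously differentiable in a neighborhood $\mathcal N$ of $\boldsymbol\theta_0$; $\sqrt n\,\nabla_{\boldsymbol\theta}Q_n(\boldsymbol\theta_0)\xrightarrow{d}N(0,\Sigma)$; there is a matrix-valued function $H(\boldsymbol\theta)$, continuous at $\boldsymbol\theta_0$, with $\sup_{\boldsymbol\theta\in\mathcal N}\|\nabla_{\boldsymbol\theta\boldsymbol\theta}Q_n(\boldsymbol\theta)-H(\boldsymbol\theta)\|\to0$ in probability; and $H=H(\boldsymbol\theta_0)$ is nonsingular; (ii) with probability one, $\tilde Q_n$ is twice continuously differentiable in the neighborhood $\mathcal N$ of $\boldsymbol\theta_0$; (iii) $\operatorname{plim}_{n\to\infty}\sup_{\boldsymbol\theta\in\Theta}|\tilde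 Q_n(\boldsymbol\theta)-Q_n(\boldsymbol\theta)|=0$; (iv) $\operatorname{plim}_{n\to\infty}\sqrt n\,\sup_{\boldsymbol\theta\in\Theta}\|\nabla_{\boldsymbol\theta}\tilde Q_n(\boldsymbol\theta)-\nabla_{\boldsymbol\theta}Q_n(\boldsymbol\theta)\|=0$; (v) $\operatorname{plim}_{n\to\infty}\sup_{\boldsymbol\theta\in\Theta}\|\nabla_{\boldsymbol\theta\boldsymbol\theta}\tilde Q_n(\boldsymbol\theta)-\nabla_{\boldsymbol\theta\boldsymbol\theta}Q_n(\boldsymbol\theta)\|=0$. Then $\sqrt n(\hat{\boldsymbol\theta}_{AM}-\boldsymbol\theta_0)\xrightarrow{d}N(\mathbf 0,H^{-1}\Sigma H^{-1})$ as $n\to\infty$.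
   Context: $\nabla_{\boldsymbol\theta}$ and $\nabla_{\boldsymbol\theta\boldsymbol\theta}$ denote gradient and Hessian with respect to $\boldsymbol\theta$; $\operatorname{plim}$ is the limit in probability and $\xrightarrow{d}$ convergence in distribution. *)

(* Defs.v *)
From HB Require Import structures.
From mathcomp Require Import all_boot all_order all_algebra.
From mathcomp Require Import all_classical all_reals all_analysis.
Set Implicit Arguments. Unset Strict Implicit. Unset Printing Implicit Defensive.
Import Order.TTheory GRing.Theory Num.Theory.
Import numFieldNormedType.Exports.
Local Open Scope classical_set_scope.
Local Open Scope ring_scope.

Section defs.
Variable R : realType.
Variable p : nat.

Definition ebasis (i : 'I_p) : 'rV[R]_p := delta_mx 0 i.

Definition grad (f : 'rV[R]_p -> R) (x : 'rV[R]_p) : 'rV[R]_p :=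
  \row_i ('D_(ebasis i) f x).
Definition hess (f : 'rV[R]_p -> R) (x : 'rV[R]_p) : 'M[R]_p :=
  \matrix_(i, j) ('D_(ebasis j) (fun y => 'D_(ebasis i) f y) x).

Definition C2_on (N : set 'rV[R]_p) (f : 'rV[R]_p -> R) : Prop :=
  forall x, N x ->
    [/\ differentiable f x,
        (forall i, differentiable (fun y => 'D_(ebasis i) f y) x) &
        (forall i j, {for x, continuous (fun y => hess f y i j)})].
End defs.

Section prob.
Variables (R : realType) (d : measure_display) (T : measurableType d).
Variable (P : probability T R).

Definition outerP (A : set T) : \bar R :=
  ereal_inf [set P B | B in [set B | measurable B /\ A `<=` B]].

(* plim Y_n = 0 for [0,+oo]-valued (possibly non-measurable) Y_n, in outer probability *)
Definition plim0 (Y : nat -> T -> \bar R) : Prop :=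
  forall e : R, 0 < e ->
    (fun n => outerP [set w | (e%:E < Y n w)%E]) @ \oo --> 0%E.
End prob.

(* Z : Omega -> R^p is a centered Gaussian random vector with covariance Sigma
   (Cramer-Wold definition: every linear form t.Z is N(0, t Sigma t^T),
    degenerate at 0 when the variance is 0) *)
Definition is_gauss_vec (R : realType) (d : measure_display) (T : measurableType d)
  (P : probability T R) (p : nat) (Z : T -> 'rV[R]_p) (S : 'M[R]_p) : Prop :=
  [/\ S^T = S,
      (forall t : 'rV[R]_p, 0 <= (t *m S *m t^T) 0 0),
      (forall i, measurable_fun setT (fun w => Z w 0 i)) &
      (forall (t : 'rV[R]_p) (A : set R), measurable A ->
         let v := (t *m S *m t^T) 0 0 in
         P [set w | A ((Z w *m t^T) 0 0)] =
           (if v == 0 then \d_(0:R) A else normal_prob 0 (Num.sqrt v) A))].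

Definition cvg_dist_normal (R : realType) (d : measure_display) (T : measurableType d)
  (P : probability T R) (p : nat) (X : nat -> T -> 'rV[R]_p) (S : 'M[R]_p) : Prop :=
  (forall n i, measurable_fun setT (fun w => X n w 0 i)) /\
  forall (d' : measure_display) (T' : measurableType d') (P' : probability T' R)
         (Z : T' -> 'rV[R]_p),
    is_gauss_vec P' Z S ->
    forall f : 'rV[R]_p -> R, continuous f -> (exists M : R, forall x, `|f x| <= M) ->
      (fun n => (\int[P]_w (f (X n w))%:E)%E) @ \oo --> (\int[P']_w (f (Z w))%:E)%E.

(* Main.v *)
(* The gradient of tilde Q_n vanishes at the maximizer, so the mean value theorem
   gives 0 = sqrt n grad tilde Q_n(theta0) + X_n M_n^T with
   X_n = sqrt n (thetaAM - theta0) and M_n a matrix of Hessian entries at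
   intermediate points; by (v) and consistency M_n is close to A = H(theta0), and
   by (iv) the gradient may be replaced by that of Q_n.  Hence X_n is close in
   outer probability to Y_n = - sqrt n grad Q_n(theta0) A^-1.
   A perturbation argument transfers weak convergence from Y_n to X_n; the
   tightness of Y_n which it needs follows from its convergence in law.
   No characteristic function is required to identify the limit: if Z is Gaussian
   with covariance A^-1 Sigma A^-1, then - Z A is Gaussian with covariance Sigma
   and the hypothesis can be applied to it.  This uses the symmetry of A, inherited
   from the Hessians of the C^2 functions Q_n (Schwarz's theorem). *)
Require Import Defs.
From HB Require Import structures.
From mathcomp Require Import all_boot all_order all_algebra.
From mathcomp Require Import all_classical all_reals all_analysis.
From mathcomp Require Import measurable_realfun ring lra.
Import Order.TTheory GRing.Theory Num.Theory.
Import numFieldNormedType.Exports.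
Local Open Scope classical_set_scope.
Local Open Scope ring_scope.

(** * Inequalities for the entrywise maximum norm of matrices *)

Lemma mx_entry_le_norm (R : realType) (m n : nat) (A : 'M[R]_(m, n)) i j :
  `|A i j| <= `|A|.
Proof.
rewrite [leRHS]/Num.norm/= mx_normrE.
by apply: (le_trans _ (le_bigmax _ (fun ij => `|A ij.1 ij.2|) (i, j))).
Qed.

Lemma mx_norm_leP (R : realType) (m n : nat) (A : 'M[R]_(m, n)) (e : R) :
  0 <= e -> (forall i j, `|A i j| <= e) -> `|A| <= e.
Proof.
move=> e0 Ae; rewrite [leLHS]/Num.norm/= mx_normrE.
by apply: bigmax_le => // -[i j] _; exact: Ae.
Qed.

(** The maximum norm is not submultiplicative: an entry of the product is a sum of [n] terms, whence
    the factor [n]. This is the origin of every factor [p%:R] in the later bounds. *)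
Lemma normr_mulmx (R : realType) (m n q : nat) (A : 'M[R]_(m, n)) (B : 'M[R]_(n, q)) :
  `|A *m B| <= n%:R * (`|A| * `|B|).
Proof.
apply: mx_norm_leP => [|i j]; first by rewrite !mulr_ge0.
rewrite mxE (le_trans (ler_norm_sum _ _ _))//.
rewrite (le_trans (ler_sum _ (G := fun=> `|A| * `|B|) _))//.
  by move=> k _; rewrite normrM ler_pM// mx_entry_le_norm.
by rewrite sumr_const card_ord mulr_natl.
Qed.

Lemma normr_trmx (R : realType) (m n : nat) (A : 'M[R]_(m, n)) : `|A^T| = `|A|.
Proof.
have le_tr k l (B : 'M[R]_(k, l)) : `|B^T| <= `|B|.
  by apply: mx_norm_leP => // i j; rewrite mxE mx_entry_le_norm.
by apply/eqP; rewrite eq_le le_tr -{1}(trmxK A) le_tr.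
Qed.

(** * Mean value theorem along segments and Schwarz's theorem *)

Lemma derive_rowE (R : realType) (p : nat) (f : 'rV[R]_p -> R) (x v : 'rV[R]_p) :
  differentiable f x -> 'D_v f x = \sum_j v 0 j * 'D_(ebasis R j) f x.
Proof.
move=> df; rewrite deriveE// {1}(row_sum_delta v) linear_sum/=.
by apply: eq_bigr => j _; rewrite linearZ/= deriveE.
Qed.

Lemma is_derive_line (R : realType) (p : nat) (f : 'rV[R]_p -> R)
    (x v : 'rV[R]_p) (t : R) :
  differentiable f (x + t *: v) ->
  is_derive t 1 (fun t : R => f (x + t *: v)) ('D_v f (x + t *: v)).
Proof.
move=> df; set F := fun t : R => f (x + t *: v).
have FE : (fun h : R => h^-1 *: ((F \o shift t) (h *: 1) - F t)) =
    (fun h : R => h^-1 *: ((f \o shift (x + t *: v)) (h *: v) - f (x + t *: v))).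
  apply/funext => h; rewrite /F/=; congr (_ *: (f _ - _)).
  by rewrite scalerDl addrCA [h *: 1]mulr1.
split; last by rewrite /derive FE.
by rewrite /derivable FE; exact: diff_derivable.
Qed.

Lemma mean_value_dir (R : realType) (p : nat) (f : 'rV[R]_p -> R) (x v : 'rV[R]_p) :
  (forall t : R, 0 <= t <= 1 -> differentiable f (x + t *: v)) ->
  exists2 t : R, 0 <= t <= 1 & f (x + v) - f x = 'D_v f (x + t *: v).
Proof.
move=> df.
have [|||t t01] := @MVT_segment R (fun t : R => f (x + t *: v))
    (fun t : R => 'D_v f (x + t *: v)) 0 1.
- by [].
- move=> t; rewrite in_itv/= => /andP[t0 t1].
  by apply: is_derive_line; apply: df; rewrite !ltW.
- apply: continuous_in_subspaceT => t; rewrite inE/= in_itv/= => t01.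
  apply: differentiable_continuous; apply/derivable1_diffP.
  by case: (is_derive_line R p f x v t (df t t01)).
rewrite scale1r scale0r addr0 subr0 mulr1 => ->.
by exists t => //; move: t01; rewrite in_itv.
Qed.

Lemma normr_ebasis_le1 (R : realType) (p : nat) (i : 'I_p) : `|ebasis R i| <= 1.
Proof.
by apply: mx_norm_leP => // k j; rewrite mxE; case: (_ && _);
  rewrite ?normr0 ?normr1.
Qed.

(** The mean value theorem is applied twice: in direction [i] to the increment [g] of [f] over
    [h *: ej], then in direction [j] to the [i]-th partial derivative. The left-hand side is
    symmetric in [i] and [j], which is what Schwarz's theorem exploits. *)
Lemma second_difference (R : realType) (p : nat) (N : set 'rV[R]_p)
    (f : 'rV[R]_p -> R) (x : 'rV[R]_p) (i j : 'I_p) (h : R) :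
  C2_on N f -> 0 <= h ->
  (forall s t : R, 0 <= s <= h -> 0 <= t <= h ->
     N (x + s *: ebasis R i + t *: ebasis R j)) ->
  exists s t : R, [/\ 0 <= s <= h, 0 <= t <= h &
    f (x + h *: ebasis R i + h *: ebasis R j) - f (x + h *: ebasis R i)
      - (f (x + h *: ebasis R j) - f x)
    = h * (h * hess f (x + s *: ebasis R i + t *: ebasis R j) i j)].
Proof.
move=> fC2 h0 xN; set ei := ebasis R i; set ej := ebasis R j.
have scale01 (t : R) : 0 <= t <= 1 -> 0 <= t * h <= h.
  by move=> /andP[t0 t1]; rewrite mulr_ge0//= ler_piMl.
pose g (y : 'rV[R]_p) := f (y + h *: ej) - f y.
have N0 (s : R) : 0 <= s <= h -> N (x + s *: ei).
  by move=> sh; have := xN s 0 sh; rewrite scale0r addr0 lexx; exact.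
have dshift (y : 'rV[R]_p) : N (y + h *: ej) ->
    differentiable (fun y : 'rV[R]_p => f (y + h *: ej)) y.
  move=> Ny; apply: (@differentiable_comp _ _ _ _ (fun y : 'rV[R]_p => y + h *: ej) f).
    by have := @differentiableD R _ _ id (cst (h *: ej)) y; apply.
  by case: (fC2 _ Ny).
have DshiftE (v y : 'rV[R]_p) :
    'D_v (fun y : 'rV[R]_p => f (y + h *: ej)) y = 'D_v f (y + h *: ej).
  by rewrite /derive/=; under [in LHS]eq_fun do rewrite -addrA.
have hh : 0 <= h <= h by rewrite h0 lexx.
have [|s s01 sE] := @mean_value_dir R p g x (h *: ei).
  move=> t t01; rewrite scalerA; apply: differentiableB.
    by apply: dshift; apply: xN => //; exact: scale01.
  by case: (fC2 _ (N0 _ (scale01 _ t01))).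
have [|t t01 tE] := @mean_value_dir R p (fun y => 'D_ei f y) (x + (s * h) *: ei) (h *: ej).
  move=> t t01; rewrite scalerA.
  by have [_ + _] := fC2 _ (xN _ _ (scale01 _ s01) (scale01 _ t01)); exact.
exists (s * h), (t * h); split; [exact: scale01|exact: scale01|].
have NN := xN _ _ (scale01 _ s01) (scale01 _ t01).
have DZ (c : R) (v y : 'rV[R]_p) (k : 'rV[R]_p -> R) : differentiable k y ->
    'D_(c *: v) k y = c * 'D_v k y.
  by move=> dk; rewrite !deriveE// linearZ.
move: tE; rewrite scalerA DZ; last by have [_ + _] := fC2 _ NN; exact.
move=> tE; rewrite mxE -/ei -/ej -tE.
move: sE; rewrite /g [LHS]/= scalerA => ->.
have Ns := N0 _ (scale01 _ s01); have Nsh := xN _ _ (scale01 _ s01) hh.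
have [dfs _ _] := fC2 _ Ns; have [dfsh _ _] := fC2 _ Nsh.
rewrite [LHS]deriveB; first by rewrite DshiftE !DZ// mulrBr.
- by apply: diff_derivable; exact: dshift.
- exact: diff_derivable.
Qed.

(** The second difference over a small square, computed in both orders and divided by the squared
    side, equates the entries [i j] and [j i] of Hessians at two points near [x]. Continuity brings
    both back to [x] up to [e]. *)
Lemma C2_on_hess_sym (R : realType) (p : nat) (N : set 'rV[R]_p)
    (f : 'rV[R]_p -> R) (x : 'rV[R]_p) :
  open N -> C2_on N f -> N x -> (hess f x)^T = hess f x.
Proof.
(* Stated for abstract reals: matching distinct [hess] terms unfolds derivatives. *)
have aux (a b u v e : R) :
    a = b -> `|u - a| < e / 2 -> `|v - b| < e / 2 -> `|v - u| <= e.
  move=> <- ua va; apply: (le_trans (ler_distD a _ _)).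
  by rewrite (distrC a); apply: ltW; rewrite [ltRHS](splitr e) ltrD.
move=> Nopen fC2 Nx; apply/matrixP => i j; rewrite mxE; apply/eqP.
rewrite -subr_eq0 -normr_le0; apply/ler_addgt0Pl => e e0; rewrite addr0.
have [_ _ hcont] := fC2 _ Nx.
have e20 : 0 < e / 2 by rewrite divr_gt0.
have /nbhs_ballP[r /= r0 rP] : \forall y \near x, [/\ N y,
    `|hess f x i j - hess f y i j| < e / 2 & `|hess f x j i - hess f y j i| < e / 2].
  near=> y; split; near: y.
  - exact: open_nbhs_nbhs.
  - by have /cvgr_dist_lt := hcont i j; apply.
  - by have /cvgr_dist_lt := hcont j i; apply.
(* With both coordinates at most [r / 3], the square stays within [2 * r / 3] of [x], strictly
   inside the ball. *)
have h0 : 0 < r / 3 by rewrite divr_gt0.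
have inball (a b : 'I_p) (s t : R) : 0 <= s <= r / 3 -> 0 <= t <= r / 3 ->
    ball x r (x + s *: ebasis R a + t *: ebasis R b).
  move=> /andP[s0 sr] /andP[t0 tr]; rewrite -ball_normE/= -addrA opprD addNKr.
  rewrite normrN (le_lt_trans (ler_normD _ _))// !normrZ !ger0_norm//.
  have := ler_piMr s0 (normr_ebasis_le1 R p a).
  have := ler_piMr t0 (normr_ebasis_le1 R p b); lra.
have [|s [t [sh th st]]] := @second_difference R p N f x i j _ fC2 (ltW h0).
  by move=> s t sh th; have [] := rP _ (inball i j s t sh th).
have [|s' [t' [sh' th' st']]] := @second_difference R p N f x j i _ fC2 (ltW h0).
  by move=> s' t' sh' th'; have [] := rP _ (inball j i s' t' sh' th').
have hE : hess f (x + s *: ebasis R i + t *: ebasis R j) i j =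
          hess f (x + s' *: ebasis R j + t' *: ebasis R i) j i.
  apply: (mulfI (lt0r_neq0 h0)); apply: (mulfI (lt0r_neq0 h0)).
  rewrite -st -st' (addrAC x); lra.
move: hE (rP _ (inball i j s t sh th)) (rP _ (inball j i s' t' sh' th')).
move: (x + _ + _) (x + _ + _) => y y' hE [_ ij _] [_ _ ji].
exact: aux hE ij ji.
Unshelve. all: by end_near. Qed.

(** * First-order condition, expansion of the gradient, and the Newton step *)

Lemma differentiable_argmax_grad (R : realType) (p : nat) (N : set 'rV[R]_p)
    (f : 'rV[R]_p -> R) (x : 'rV[R]_p) :
  open N -> N x -> (forall y, N y -> differentiable f y) ->
  (forall y, N y -> f y <= f x) -> grad f x = 0.
Proof.
move=> Nopen Nx df fmax; apply/rowP => i; rewrite !mxE.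
have /nbhs_ballP[r /= r0 rN] : nbhs x N by exact: open_nbhs_nbhs.
have lineN (t : R) : t \in `]- r, r[ -> N (x + t *: ebasis R i).
  rewrite in_itv/= => tr; apply: rN; rewrite -ball_normE/= opprD addNKr normrN normrZ.
  apply: (le_lt_trans (ler_piMr (normr_ge0 _) (normr_ebasis_le1 R p i))).
  by rewrite ltr_norml.
have xE : x = x + (0 : R) *: ebasis R i by rewrite scale0r addr0.
have r0r : (0 : R) \in `]- r, r[ by rewrite in_itv/= oppr_lt0 r0.
have [||||_ D0] := @derive1_at_max R (fun t : R => f (x + t *: ebasis R i)) (- r) r 0.
- by rewrite ge0_cp// ltW.
- by move=> t tr; have [] := is_derive_line R p f x _ t (df _ (lineN _ tr)).
- by [].
- by move=> t tr; rewrite -xE; exact/fmax/lineN.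
have [_] := is_derive_line R p f x _ 0 (df _ (lineN _ r0r)).
by rewrite D0 -xE.
Qed.

(* The rows of [M] are rows of Hessians taken at different points, since the
   mean value theorem only applies to one component of the gradient at a time. *)
Lemma grad_mean_value (R : realType) (p : nat) (N : set 'rV[R]_p)
    (f : 'rV[R]_p -> R) (x y : 'rV[R]_p) (r : R) :
  C2_on N f -> ball x r `<=` N -> ball x r y ->
  exists M : 'M[R]_p, grad f y = grad f x + (y - x) *m M^T /\
    forall i, exists2 z, ball x r z & row i M = row i (hess f z).
Proof.
move=> fC2 rN xy.
have seg (t : R) : 0 <= t <= 1 -> ball x r (x + t *: (y - x)).
  move=> /andP[t0 t1]; move: xy; rewrite -!ball_normE/= opprD addNKr normrN normrZ.
  by rewrite (distrC x) ger0_norm//; apply/le_lt_trans/ler_piMl.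
have /choice[z zP] (i : 'I_p) : exists z, ball x r z /\
    grad f y 0 i - grad f x 0 i = \sum_j (y - x) 0 j * hess f z i j.
  have [|t t01] := @mean_value_dir R p (fun u => 'D_(ebasis R i) f u) x (y - x).
    by move=> t t01; have [_ + _] := fC2 _ (rN _ (seg t t01)); exact.
  rewrite (addrC x) subrK => fE; exists (x + t *: (y - x)); split; first exact: seg.
  rewrite !mxE fE derive_rowE; last first.
    by have [_ + _] := fC2 _ (rN _ (seg t t01)); exact.
  by apply: eq_bigr => j _; rewrite [hess _ _ _ _]mxE.
exists (\matrix_(i, j) hess f (z i) i j); split.
  apply/rowP => i; have [_ /eqP] := zP i; rewrite subr_eq addrC => /eqP ->.
  rewrite [RHS]mxE [(_ *m _) _ _]mxE; congr (_ + _).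
  by apply: eq_bigr => j _; congr (_ * _); rewrite [RHS]mxE [RHS]mxE.
move=> i; exists (z i); first by have [] := zP i.
by apply/rowP => j; rewrite !mxE.
Qed.

(** The error [W] satisfies [W = (- E + X *m (A - M)) *m invmx A], and [X] is itself at most [K]
    plus the norm of [W]. The resulting term in [W] on the right has coefficient at most [1 / 2];
    absorbing it on the left produces the factor [2]. *)
Lemma newton_step_bound (R : realType) (p : nat) (A M : 'M[R]_p)
    (X G E : 'rV[R]_p) (delta K : R) :
  A \in unitmx -> 0 = G + E + X *m M ->
  `|E| <= delta -> `|M - A| <= delta -> `|G *m invmx A| <= K ->
  p%:R * (p%:R * delta * `|invmx A|) <= 1 / 2 ->
  `|X + G *m invmx A| <= 2 * (p%:R * (1 + p%:R * K) * `|invmx A|) * delta.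
Proof.
move=> Aunit XE Ed Md GK small.
have d0 : 0 <= delta by rewrite (le_trans _ Ed).
set c := `|invmx A|; set W := X + G *m invmx A.
have WE : W = (- E + X *m (A - M)) *m invmx A.
  have -> : - E + X *m (A - M) = X *m A + G.
    move/eqP: XE; rewrite eq_sym addr_eq0 => /eqP XE.
    by rewrite mulmxBr -XE addrC -!addrA subrr addr0.
  by rewrite mulmxDl mulmxK.
have XW : `|X| <= K + `|W|.
  rewrite -[X](addrK (G *m invmx A)) (le_trans (ler_normB _ _))// addrC lerD//.
have : `|W| <= p%:R * ((delta + p%:R * ((K + `|W|) * delta)) * c).
  rewrite {1}WE (le_trans (normr_mulmx _ _ _ _ _ _))// ler_wpM2l// ler_wpM2r//.
  rewrite (le_trans (ler_normD _ _))// normrN lerD//.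
  rewrite (le_trans (normr_mulmx _ _ _ _ _ _))// ler_wpM2l// ler_pM// distrC//.
have := ler_wpM2r (normr_ge0 W) small; rewrite -/c.
move: `|W| => w; move: (p%:R : R) => q; nra.
Qed.

(** * Consistency of the maximizer *)

(** [Theta] minus the open ball is compact, so [Q0] attains its maximum there, at a point other than
    [theta0]; [eta] is the resulting deficit. If that set is empty, any positive [eta] will do. *)
Lemma unique_max_gap (R : realType) (p : nat) (Theta : set 'rV[R]_p)
    (Q0 : 'rV[R]_p -> R) (theta0 : 'rV[R]_p) (r : R) :
  compact Theta -> {within Theta, continuous Q0} -> 0 < r ->
  (forall theta, Theta theta -> theta != theta0 -> Q0 theta < Q0 theta0) ->
  exists2 eta : R, 0 < eta & forall theta, Theta theta ->
    ~ ball theta0 r theta -> Q0 theta + eta <= Q0 theta0.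
Proof.
move=> cT cQ r0 Qmax.
pose K := Theta `&` ~` ball theta0 r.
have cK : compact K.
  by apply: compact_closedI => //; apply: open_closedC; exact: ball_open.
have [[z0 Kz0]|K0] := pselect (K !=set0); last first.
  by exists 1 => // t Tt rt; exfalso; apply: K0; exists t.
have [||z + zmax] := @EVT_max_rV R p Q0 K _ cK; first by exists z0.
  by apply: continuous_subspaceW cQ => t [].
rewrite inE => -[Tz rz].
exists (Q0 theta0 - Q0 z).
  rewrite subr_gt0; apply: Qmax => //; apply/eqP => zE; apply: rz.
  by rewrite zE; exact: ballxx.
move=> t Tt rt; rewrite addrCA gerDl subr_le0.
by apply: zmax; rewrite inE.
Qed.

(** Going from [Q0 theta0] through [Q] and [Qt] to [Qt theta] and back to [Q0 theta] costs four
    errors below [eta / 4]. Hence [Q0 theta0 < Q0 theta + eta], which the gap forbids outside the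
    ball. *)
Lemma near_argmax_in_ball (R : realType) (p : nat) (Theta : set 'rV[R]_p)
    (Q0 Q Qt : 'rV[R]_p -> R) (theta0 theta : 'rV[R]_p) (r eta : R) :
  (forall theta, Theta theta -> ~ ball theta0 r theta -> Q0 theta + eta <= Q0 theta0) ->
  Theta theta0 -> Theta theta -> Qt theta0 <= Qt theta ->
  (forall theta, Theta theta -> `|Q theta - Q0 theta| < eta / 4) ->
  (forall theta, Theta theta -> `|Qt theta - Q theta| < eta / 4) ->
  ball theta0 r theta.
Proof.
move=> gap T0 T1 Qt01 QQ0 QtQ; apply/not_notP => /(gap _ T1).
move: (QQ0 _ T0) (QQ0 _ T1) (QtQ _ T0) (QtQ _ T1).
rewrite !ltr_norml; lra.
Qed.

(** * Weak convergence of random vectors under small perturbations *)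

(* [f \o X] is the pointwise limit of [f] applied to the coordinates of [X] rounded down to a
   grid, which takes countably many values. *)
Lemma measurable_continuous_rV (R : realType) (d : measure_display)
    (T : measurableType d) (p : nat) (f : 'rV[R]_p -> R) (X : T -> 'rV[R]_p) :
  continuous f -> (forall i, measurable_fun setT (fun w => X w 0 i)) ->
  measurable_fun setT (fun w => f (X w)).
Proof.
move=> fc mX.
pose c (k : nat) w : {ffun 'I_p -> int} := [ffun i => Num.floor (k.+1%:R * X w 0 i)].
pose r (k : nat) (z : {ffun 'I_p -> int}) : 'rV[R]_p := \row_i ((z i)%:~R / k.+1%:R).
apply: (@measurable_fun_cvg _ _ _ _ (fun k w => f (r k (c k w)))) => [k|w _].
  move=> _ B mB; rewrite setTI.
  have -> : (fun w => f (r k (c k w))) @^-1` B =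
      \bigcup_(z in [set: {ffun 'I_p -> int}])
        if pselect (B (f (r k z))) then [set w | c k w = z] else set0.
    apply/seteqP; split=> [w /= Bw|w [z _]]; first by exists (c k w) => //; case: pselect.
    by case: pselect => //= Bz wz; rewrite wz.
  apply: countable_bigcupT_measurable => [|z]; first exact: countableP.
  case: pselect => //= _.
  have -> : [set w | c k w = z] =
      \bigcap_(i in [set: 'I_p]) [set w | (z i)%:~R <= k.+1%:R * X w 0 i < (z i + 1)%:~R].
    apply/seteqP; split=> [w /= <- i _|w /= wz].
      by rewrite /= ffunE; exact: floor_itv.
    by apply/ffunP => i; rewrite ffunE; apply: floor_def; exact: wz.
  apply: fin_bigcap_measurable => // i _.
  have mk : measurable_fun setT (fun w => k.+1%:R * X w 0 i).
    exact: measurable_funM.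
  have := mk measurableT `[(z i)%:~R, (z i + 1)%:~R[%classic (measurable_itv _).
  by rewrite setTI; congr (measurable _); apply/seteqP; split => u /=; rewrite in_itv.
apply: (@cvg_comp _ _ _ (fun k => r k (c k w)) f _ (nbhs (X w))); last exact: fc.
apply/cvgrPdist_le => e e0; near=> k; apply: mx_norm_leP => [|i j]; first exact: ltW.
rewrite !mxE ffunE ord1.
have /andP[lo hi] := floor_itv (k.+1%:R * X w 0 j).
have k0 : 0 < k.+1%:R :> R by rewrite ltr0n.
have ke : 1 / k.+1%:R <= e.
  rewrite div1r; near: k.
  have /cvgrPdist_le /(_ _ e0) := @cvg_harmonic R; apply: filterS => m.
  by rewrite sub0r normrN ger0_norm// harmonic_ge0.
move: lo hi; set m := Num.floor _; rewrite intrD1 => lo hi.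
have -> : X w 0 j = k.+1%:R * X w 0 j / k.+1%:R by rewrite mulrAC mulfV ?mul1r// gt_eqF.
rewrite -mulrBl ger0_norm; last by rewrite divr_ge0// subr_ge0.
apply: le_trans ke; rewrite ler_wpM2r ?invr_ge0//.
by rewrite lerBlDl ltW.
Unshelve. all: by end_near. Qed.

(** Only [x] is confined to the compact ball, while [y] may leave it, so this is slightly more than
    uniform continuity on a compact set. The covering form of compactness, along the filter [0^'+],
    makes one [eta] work for all [x]. *)
Lemma uniform_continuous_bounded (R : realType) (p : nat) (f : 'rV[R]_p -> R) (K e : R) :
  continuous f -> 0 < e ->
  exists2 eta : R, 0 < eta & forall x y : 'rV[R]_p,
    `|x| <= K -> `|y - x| <= eta -> `|f y - f x| <= e.
Proof.
move=> fc e0.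
have cK : compact [set x : 'rV[R]_p | `|x| <= K].
  apply: bounded_closed_compact.
    by exists K; split; [exact: num_real | move=> M KM x /= xK; exact/ltW/(le_lt_trans xK)].
  have -> : [set x : 'rV[R]_p | `|x| <= K] = closed_ball_ Num.Def.normr 0 K.
    by apply/seteqP; split => x; rewrite /closed_ball_/= sub0r normrN.
  exact: closed_closed_ball_.
have near_eta := (compact_near_coveringP _).1 cK R 0^'+
  (fun eta x => forall y : 'rV[R]_p, `|y - x| <= eta -> `|f y - f x| <= e) _ _.
have /filter_ex[eta [eta0 etaP]] : \forall eta \near 0^'+, 0 < eta /\
    forall x : 'rV[R]_p, `|x| <= K ->
      forall y : 'rV[R]_p, `|y - x| <= eta -> `|f y - f x| <= e.
  apply: filterI; first exact: nbhs_right_gt.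
  apply: near_eta.
  move=> x _; have e20 : 0 < e / 2 by rewrite divr_gt0.
  have /nbhs_ballP[r /= r0 rP] : \forall z \near x, `|f x - f z| < e / 2.
    by have /cvgr_dist_lt := fc x; apply.
  have r20 : 0 < r / 2 by rewrite divr_gt0.
  exists (ball x (r / 2), [set eta : R | eta < r / 2]) => /=.
    by split; [exact: nbhsx_ballx | exact: nbhs_right_lt].
  move=> [x' eta] [/= xx' etar] y yx'.
  have bx' : ball x r x' by apply: le_ball xx'; rewrite ler_pdivrMr// ler_peMr ?ltW// ltr1n.
  have bxy : ball x r y.
    rewrite (splitr r); apply: (@ball_triangle _ _ x'); first exact: xx'.
    by rewrite -ball_normE/= distrC (le_lt_trans yx').
  rewrite (le_trans (ler_distD (f x) _ _))// [leRHS](splitr e) lerD//.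
    by rewrite distrC; apply/ltW/rP.
  by apply/ltW/rP.
by exists eta => // x y xK yx; exact: etaP.
Qed.

Lemma bounded_continuous_integrable (R : realType) (d : measure_display)
    (T : measurableType d) (P : probability T R) (p : nat) (f : 'rV[R]_p -> R)
    (M : R) (X : T -> 'rV[R]_p) :
  continuous f -> (forall x, `|f x| <= M) ->
  (forall i, measurable_fun setT (fun w => X w 0 i)) ->
  P.-integrable setT (EFin \o (fun w => f (X w))).
Proof.
move=> fc fM mX; apply: measurable_bounded_integrable => //.
- by rewrite (le_lt_trans (probability_le1 P measurableT))// ltry.
- exact: measurable_continuous_rV.
- exists M; split; first exact: num_real.
  by move=> M' MM' w _ /=; rewrite (le_trans (fM _))// ltW.
Qed.

(* A continuous weight that controls the indicator of [K <= `|x|]. *)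
Definition tail_weight (R : realType) (p : nat) (K : R) (x : 'rV[R]_p) : R :=
  `|x| / (K + `|x|).

Lemma continuous_tail_weight (R : realType) (p : nat) (K : R) :
  0 < K -> continuous (@tail_weight R p K).
Proof.
move=> K0 x.
have cn : `|y| @[y --> x] --> `|x| := @norm_continuous _ _ x.
apply: (@cvgM R _ (nbhs x) _ (fun y : 'rV[R]_p => `|y|) (fun y => (K + `|y|)^-1)) => //.
apply: cvgV; first by rewrite gt_eqF// ltr_wpDr.
by apply: cvgD => //; exact: cvg_cst.
Qed.

Lemma tail_weight_ge0 (R : realType) (p : nat) (K : R) (x : 'rV[R]_p) :
  0 < K -> 0 <= tail_weight R p K x.
Proof. by move=> K0; rewrite divr_ge0// addr_ge0// ltW. Qed.

Lemma tail_weight_le1 (R : realType) (p : nat) (K : R) (x : 'rV[R]_p) :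
  0 < K -> tail_weight R p K x <= 1.
Proof.
by move=> K0; rewrite ler_pdivrMr ?ltr_wpDr// mul1r lerDr ltW.
Qed.

Lemma norm_tail_weight_le1 (R : realType) (p : nat) (K : R) (x : 'rV[R]_p) :
  0 < K -> `|tail_weight R p K x| <= 1.
Proof.
by move=> K0; rewrite ger0_norm ?tail_weight_le1// tail_weight_ge0.
Qed.

Lemma tail_weight_ge_half (R : realType) (p : nat) (K : R) (x : 'rV[R]_p) :
  0 < K -> K <= `|x| -> 1 <= 2 * tail_weight R p K x.
Proof.
move=> K0 Kx; rewrite mulrA ler_pdivlMr ?ltr_wpDr// mul1r mulr_natl mulr2n.
by rewrite lerD2r.
Qed.

(** Dominated convergence: the weights are bounded by [1] and tend to [0] pointwise as [K] grows
    through the positive integers. *)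
Lemma tail_weight_integral_small (R : realType) (d : measure_display)
    (T : measurableType d) (P : probability T R) (p : nat) (Z : T -> 'rV[R]_p) (e : R) :
  (forall i, measurable_fun setT (fun w => Z w 0 i)) -> 0 < e ->
  exists2 K : R, 0 < K & (\int[P]_w (tail_weight R p K (Z w))%:E < e%:E)%E.
Proof.
move=> mZ e0.
pose h (k : nat) w := (tail_weight R p k.+1%:R (Z w))%:E.
have k0 (k : nat) : 0 < k.+1%:R :> R by rewrite ltr0n.
have ih k : P.-integrable setT (h k).
  apply: (@bounded_continuous_integrable R d T P p _ 1) => //.
    exact: continuous_tail_weight.
  by move=> x; exact: norm_tail_weight_le1.
have [|||||_ _] := @dominated_convergence _ T R P setT measurableT h (cst 0%E)
    (EFin \o cst 1) _ _ _ _ _.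
- by move=> k; exact: (measurable_int P).
- exact: measurable_cst.
- apply: aeW => w _; apply: cvg_EFin; first by near=> k.
  rewrite /h /comp /=; apply/cvgrPdist_le => e' e'0.
  (* The weight is at most [(1 + t) / k.+1] with [t] the norm of [Z w]; the [1] keeps the divisor
     positive when [Z w] is zero. *)
  have [/= N _ Nk] : \forall k \near \oo, k.+1%:R^-1 <= e' / (1 + `|Z w|) :> R.
    have : 0 < e' / (1 + `|Z w|) by rewrite divr_gt0// ltr_wpDr.
    have /cvgrPdist_le h0 := @cvg_harmonic R; move/h0; apply: filterS => k.
    by rewrite sub0r normrN ger0_norm// harmonic_ge0.
  exists N => // k /Nk kN; rewrite sub0r normrN ger0_norm ?tail_weight_ge0//.
  have := kN; rewrite ler_pdivlMr ?ltr_wpDr// => {}kN.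
  apply: le_trans kN; rewrite mulrC /tail_weight ler_pM ?invr_ge0 ?addr_ge0//.
    by rewrite lerDr.
  by rewrite lef_pV2 ?posrE ?ltr_wpDr// lerDl.
- exact: finite_measure_integrable_cst.
- by apply: aeW => w k _; rewrite /h /= lee_fin norm_tail_weight_le1.
rewrite integral0 => /fine_cvgP[_] /cvgrPdist_lt /(_ _ e0).
case=> N _ /(_ N (leqnn _)) /=; rewrite sub0r normrN => hN.
exists N.+1%:R => //; rewrite -[ltLHS]fineK; last exact: integrable_fin_num (ih N).
by rewrite lte_fin (le_lt_trans (ler_norm _)).
Unshelve. all: by end_near. Qed.

(** A Slutsky-type transfer in which [X n] need be close to [Y n] only where [Y n] is bounded by
    [K], off a set of small probability. The region where [Y n] is large is controlled by the
    weight, whose expectation converges along with the law of [Y n]. *)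
Lemma expectation_cvg_perturb (R : realType) (d d' : measure_display)
    (T : measurableType d) (T' : measurableType d') (P : probability T R)
    (P' : probability T' R) (p : nat) (X Y : nat -> T -> 'rV[R]_p) (Z : T' -> 'rV[R]_p) :
  (forall n i, measurable_fun setT (fun w => X n w 0 i)) ->
  (forall n i, measurable_fun setT (fun w => Y n w 0 i)) ->
  (forall i, measurable_fun setT (fun w => Z w 0 i)) ->
  (forall f : 'rV[R]_p -> R, continuous f -> (exists M : R, forall x, `|f x| <= M) ->
    (fun n => (\int[P]_w (f (Y n w))%:E)%E) @ \oo --> (\int[P']_w (f (Z w))%:E)%E) ->
  (forall K eta delta : R, 0 < K -> 0 < eta -> 0 < delta ->
    \forall n \near \oo, exists B, [/\ measurable B, (P B < delta%:E)%E &
      forall w, ~ B w -> `|Y n w| <= K -> `|X n w - Y n w| <= eta]) ->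
  forall f : 'rV[R]_p -> R, continuous f -> (exists M : R, forall x, `|f x| <= M) ->
    (fun n => (\int[P]_w (f (X n w))%:E)%E) @ \oo --> (\int[P']_w (f (Z w))%:E)%E.
Proof.
move=> mX mY mZ YZ XY f fc [M fM].
have M0 : 0 <= M by exact: le_trans (fM 0).
have iX n := bounded_continuous_integrable R d T P p f M (X n) fc fM (mX n).
have iY n := bounded_continuous_integrable R d T P p f M (Y n) fc fM (mY n).
have iZ := bounded_continuous_integrable R d' T' P' p f M Z fc fM mZ.
have := YZ f fc (ex_intro _ M fM).
rewrite -[X in _ --> X -> _](fineK (integrable_fin_num measurableT iZ)).
move=> /fine_cvgP[_ /cvgrPdist_lt cY].
rewrite -[X in _ --> X](fineK (integrable_fin_num measurableT iZ)).
apply/fine_cvgP; split.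
  by near=> n; exact: (integrable_fin_num measurableT (iX n)).
apply/cvgrPdist_le => e e0; move: cY.
set l := fine (\int[P']_w (f (Z w))%:E)%E; move=> cY.
have e4 : 0 < e / 4 by rewrite divr_gt0.
(* The [+ 1] covers [M = 0]. As [4 * M * dl <= e / 4], the final total is at most
   [e / 4 + e / 8 + e / 4 + e / 4], below [e]. *)
have d0 : 0 < e / 4 / (4 * M + 1) by rewrite divr_gt0// ltr_wpDl// mulr_ge0.
set dl := e / 4 / (4 * M + 1) in d0 *.
have dlM : 4 * M * dl <= e / 4.
  rewrite /dl mulrA ler_pdivrMr ?ltr_wpDl ?mulr_ge0//.
  by rewrite mulrDr mulr1 mulrC lerDl ltW.
have [K K0 KZ] := tail_weight_integral_small R d' T' P' p Z dl mZ d0.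
have [eta eta0 etaP] := uniform_continuous_bounded R p f K (e / 4) fc e4.
have itw n : P.-integrable setT (EFin \o (fun w => tail_weight R p K (Y n w))).
  apply: (bounded_continuous_integrable R d T P p _ 1) => //.
    exact: continuous_tail_weight.
  by move=> x; exact: norm_tail_weight_le1.
(* Tightness of [Y n]: the weight is itself a bounded continuous test function, so for large [n] its
   expectation inherits the bound chosen under the law of [Z]. *)
have nearK : \forall n \near \oo, \int[P]_w tail_weight R p K (Y n w) < dl.
  have cK := YZ _ (continuous_tail_weight R p K K0)
    (ex_intro (fun M : R => forall x, `|tail_weight R p K x| <= M) 1
      (fun x => norm_tail_weight_le1 R p K x K0)).
  have izK : P'.-integrable setT (EFin \o (fun w => tail_weight R p K (Z w))).
    apply: (bounded_continuous_integrable R d' T' P' p _ 1) => //.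
      exact: continuous_tail_weight.
    by move=> x; exact: norm_tail_weight_le1.
  move: cK; rewrite -[X in _ --> X -> _](fineK (integrable_fin_num measurableT izK)).
  move=> /fine_cvgP[_ /cvgr_lt/(_ dl)]; apply.
  by rewrite -lte_fin fineK// (integrable_fin_num measurableT izK).
near=> n.
have [B [mB PB BXY]] : exists B, [/\ measurable B, (P B < dl%:E)%E &
      forall w, ~ B w -> `|Y n w| <= K -> `|X n w - Y n w| <= eta].
  by near: n; exact: XY.
have tn : \int[P]_w tail_weight R p K (Y n w) < dl by near: n.
have yn : `|l - \int[P]_w f (Y n w)| < e / 4 by near: n; exact: cY.
have iB : P.-integrable setT (EFin \o (\1_B : T -> R)) by exact: integrable_indic.
have iBM : P.-integrable setT (EFin \o (fun w => 2 * M * \1_B w)).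
  exact: (integrableZl measurableT (2 * M) iB).
have itM : P.-integrable setT (EFin \o (fun w => 4 * M * tail_weight R p K (Y n w))).
  exact: (integrableZl measurableT (4 * M) (itw n)).
have isum : P.-integrable setT
    (EFin \o (fun w => 2 * M * \1_B w + 4 * M * tail_weight R p K (Y n w))).
  exact: (integrableD measurableT iBM itM).
have ie : P.-integrable setT (EFin \o cst (e / 4)).
  exact: finite_measure_integrable_cst.
have ibound : P.-integrable setT
    (EFin \o (fun w => e / 4 + (2 * M * \1_B w + 4 * M * tail_weight R p K (Y n w)))).
  exact: (integrableD measurableT ie isum).
have iXY : P.-integrable setT (EFin \o (fun w => f (X n w) - f (Y n w))).
  exact: (integrableB measurableT (iX n) (iY n)).
have XYn : `|\int[P]_w f (X n w) - \int[P]_w f (Y n w)| <= e / 4 + (2 * M * dl + 4 * M * dl).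
  rewrite -RintegralB//; apply: (le_trans (le_normr_Rintegral _ _)) => //.
  (* Pointwise there are three cases: on [B] the crude bound [2 * M]; off [B] with [Y n w] bounded
     by [K], uniform continuity; otherwise [2 * M] again, dominated through the weight, which is
     then at least one half. *)
  apply: (@le_trans _ _ (\int[P]_w
      (e / 4 + (2 * M * \1_B w + 4 * M * tail_weight R p K (Y n w))))).
    apply: le_Rintegral => //; first exact: integrable_norm.
    move=> w _; have twge0 := tail_weight_ge0 R p K (Y n w) K0.
    have Mtw0 : 0 <= 4 * M * tail_weight R p K (Y n w).
      by exact: mulr_ge0 (mulr_ge0 _ M0) twge0.
    have f2M : `|f (X n w) - f (Y n w)| <= 2 * M.
      by rewrite (le_trans (ler_normB _ _))// mulr_natl mulr2n lerD.
    have [Bw|nBw] := pselect (B w).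
      by rewrite indicE mem_set// mulr1 (le_trans f2M)// addrCA lerDl addr_ge0// ltW.
    rewrite indicE memNset// mulr0 add0r.
    have [YK|/ltW KY] := leP `|Y n w| K.
      by rewrite (le_trans (etaP _ _ YK (BXY _ nBw YK)))// lerDl.
    have := tail_weight_ge_half R p K _ K0 KY.
    move: f2M; move: (tail_weight _ _ _ _) => t; move: `|_ - _| => a; nra.
  rewrite (RintegralD measurableT ie isum) Rintegral_cst//.
  rewrite [fine _](_ : _ = 1); last exact: (congr1 fine (probability_setT P)).
  rewrite mulr1 lerD2l.
  rewrite (RintegralD measurableT iBM itM).
  rewrite !RintegralZl// lerD// ler_wpM2l ?mulr_ge0//; last exact: ltW.
  by rewrite /Rintegral integral_indic// setIT -lee_fin fineK ?fin_num_measure// ltW.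
rewrite (le_trans (ler_distD (\int[P]_w f (Y n w)) _ _))//.
rewrite (distrC (\int[P]_w f (Y n w))) /comp -/(Rintegral _ _ _).
move: XYn yn; rewrite /comp; lra.
Unshelve. all: by end_near. Qed.

(** * Convergence in outer probability and linear images of Gaussian vectors *)

(** An outer probability below [delta] yields a measurable cover of the bad event that is still
    below [delta]. Later arguments are then deterministic off a measurable set, although the suprema
    themselves may be non-measurable. *)
Lemma plim0_near (R : realType) (d : measure_display) (T : measurableType d)
    (P : probability T R) (Y : nat -> T -> \bar R) (e delta : R) :
  plim0 P Y -> 0 < e -> 0 < delta ->
  \forall n \near \oo, exists B, [/\ measurable B, (P B < delta%:E)%E &
    forall w, ~ B w -> (Y n w <= e%:E)%E].
Proof.
move=> Y0 e0 delta0.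
have near_outer : \forall n \near \oo, (outerP P [set w | (e%:E < Y n w)%E] < delta%:E)%E.
  have /fine_cvgP[nfin /cvgr_lt/(_ _ delta0)] := Y0 _ e0.
  by apply: filterS2 nfin => n nfin; rewrite /= -lte_fin fineK.
apply: filterS near_outer => n /ereal_inf_lt[_ [B [mB BY] <-] PB].
by exists B; split => // w nBw; rewrite leNgt; apply/negP => /BY.
Qed.

Lemma continuous_mulmxr (R : realType) (p q : nat) (A : 'M[R]_(p, q)) :
  continuous (fun x : 'rV[R]_p => x *m A).
Proof.
move=> x; apply/(@cvgrPdist_le _ _ _ (nbhs x)) => e e0.
have c0 : 0 < p%:R * `|A| + 1 by rewrite ltr_wpDl// mulr_ge0.
have ec0 : 0 < e / (p%:R * `|A| + 1) by rewrite divr_gt0.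
have : \forall y \near x, `|x - y| < e / (p%:R * `|A| + 1).
  by apply/nbhs_ballP; exists (e / (p%:R * `|A| + 1)) => //= y; rewrite -ball_normE.
apply: filterS => y /ltW; rewrite ler_pdivlMr// => /(le_trans _); apply.
rewrite -mulmxBl (le_trans (normr_mulmx _ _ _ _ _ _))// mulrCA ler_wpM2l//.
by rewrite lerDl.
Qed.

Lemma measurable_mulmxr (R : realType) (d : measure_display) (T : measurableType d)
    (p q : nat) (A : 'M[R]_(p, q)) (X : T -> 'rV[R]_p) :
  (forall i, measurable_fun setT (fun w => X w 0 i)) ->
  forall i, measurable_fun setT (fun w => (X w *m A) 0 i).
Proof.
move=> mX i; rewrite [X in measurable_fun _ X](_ : _ = fun w => \sum_j X w 0 j * A j i).
  by apply: measurable_sum => j; exact: measurable_funM.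
by apply/funext => w; rewrite mxE.
Qed.

(** In the Cramer-Wold definition, the linear form [t] of [Z *m A] is the linear form [t *m A^T] of
    [Z]. *)
Lemma is_gauss_vec_mulmx (R : realType) (d : measure_display) (T : measurableType d)
    (P : probability T R) (p : nat) (Z : T -> 'rV[R]_p) (V A : 'M[R]_p) :
  is_gauss_vec P Z V -> is_gauss_vec P (fun w => Z w *m A) (A^T *m V *m A).
Proof.
move=> [Vsym Vpos mZ ZV].
have tE (t : 'rV[R]_p) :
    t *m (A^T *m V *m A) *m t^T = (t *m A^T) *m V *m (t *m A^T)^T.
  by rewrite trmx_mul trmxK !mulmxA.
split.
- by rewrite !trmx_mul trmxK Vsym mulmxA.
- by move=> t; rewrite tE.
- exact: measurable_mulmxr.
- move=> t B mB; rewrite tE; apply: etrans (ZV (t *m A^T) B mB).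
  by congr (P _); apply/seteqP; split => w /=; rewrite trmx_mul trmxK mulmxA.
Qed.

(** * Symmetry of the limit Hessian, linearization at the maximizer, and the limit law *)

Lemma ereal_sup_norm_le (R : realType) (T : Type) (V : normedModType R)
    (S : set T) (g : T -> V) (e : R) (t : T) :
  (ereal_sup [set (`|g x|)%:E | x in S] <= e%:E)%E -> S t -> `|g t| <= e.
Proof.
move=> supe St; rewrite -lee_fin; apply: le_trans supe.
by apply: ereal_sup_ubound; exists t.
Qed.

(** The limit is deterministic, so for each [e] a single [n] and a single sample point suffice: an
    exceptional set of probability below [1] misses some [w], where a symmetric Hessian lies within
    [e / 2] of [H theta0]. *)
Lemma limit_hess_sym (R : realType) (d : measure_display) (T : measurableType d)
    (P : probability T R) (p : nat) (N : set 'rV[R]_p)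
    (Q : nat -> T -> 'rV[R]_p -> R) (theta0 : 'rV[R]_p) (H : 'rV[R]_p -> 'M[R]_p) :
  open N -> N theta0 -> (forall n w, C2_on N (Q n w)) ->
  plim0 P (fun n w => ereal_sup [set (`|hess (Q n w) theta - H theta|)%:E | theta in N]) ->
  (H theta0)^T = H theta0.
Proof.
move=> Nopen N0 QC2 QH; apply/eqP; rewrite -subr_eq0 -normr_le0.
apply/ler_addgt0Pl => e e0; rewrite addr0.
have e20 : 0 < e / 2 by rewrite divr_gt0.
have [n _ /(_ n (leqnn _))[B [mB PB BH]]] := plim0_near R d T P _ (e / 2) 1 QH e20 ltr01.
have [w nBw] : exists w, ~ B w.
  apply: contrapT => /forallNP allB; move: PB.
  rewrite (_ : B = setT) ?probability_setT ?ltxx//.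
  by apply/seteqP; split => // w _; exact: contrapT.
have := ereal_sup_norm_le _ _ _ _ _ _ _ (BH w nBw) N0.
have := C2_on_hess_sym R p N (Q n w) theta0 Nopen (QC2 n w) N0.
move: (hess (Q n w) theta0) => S Ssym SH.
rewrite (le_trans (ler_distD S _ _))// [leRHS]splitr lerD//.
by rewrite -{1}Ssym -linearB/= normr_trmx distrC.
Qed.

(** The deterministic core, for one sample point: [a] stands for the square root of [n], [q] for the
    approximate objective, and [g] for the gradient of the exact objective at [x]. *)
Lemma argmax_linearization (R : realType) (p : nat) (N : set 'rV[R]_p)
    (q : 'rV[R]_p -> R) (x y g : 'rV[R]_p) (A : 'M[R]_p) (r a s K : R) :
  open N -> ball x r `<=` N -> C2_on N q -> ball x r y ->
  (forall z, N z -> q z <= q y) -> A \in unitmx -> A^T = A ->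
  0 <= s -> `|a *: (grad q x - g)| <= s ->
  (forall z, ball x r z -> `|hess q z - A| <= s) ->
  `|(a *: g) *m invmx A| <= K -> p%:R * (p%:R * s * `|invmx A|) <= 1 / 2 ->
  `|a *: (y - x) + (a *: g) *m invmx A| <=
    2 * (p%:R * (1 + p%:R * K) * `|invmx A|) * s.
Proof.
move=> Nopen rN qC2 xy qmax Aunit Asym s0 gs hs GK small.
have gy : grad q y = 0.
  apply: (@differentiable_argmax_grad R p N) => //; first exact: rN.
  by move=> z /qC2[].
have [M [qy rowM]] := grad_mean_value R p N q x y r qC2 rN xy.
apply: (@newton_step_bound R p A M^T _ _ (a *: (grad q x - g)) s K) => //.
  by rewrite -scalemxAl -!scalerDr (addrC g) subrK -qy gy scaler0.
(* Symmetry of [A] removes the transpose on [M]; each row of [M] is then compared with [A] through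
   the Hessian at its own intermediate point. *)
rewrite -{1}Asym -linearB/= normr_trmx; apply: mx_norm_leP => // i j.
have [z xz /rowP /(_ j)] := rowM i; rewrite !mxE => Mz.
have := mx_entry_le_norm R p p (hess q z - A) i j.
by rewrite !mxE Mz => /le_trans; apply; exact: hs.
Qed.

(** This identifies the covariance of [Z *m (- A)] when [Z] has the claimed limit covariance; the
    sign matches that of the linearization [G n w *m (- invmx A)]. *)
Lemma sandwich_mulmxN (R : realType) (p : nat) (A S : 'M[R]_p) :
  A \in unitmx -> A^T = A -> (- A)^T *m (invmx A *m S *m invmx A) *m (- A) = S.
Proof.
move=> Aunit Asym.
have -> : (- A)^T = - A by rewrite -{2}Asym; apply/matrixP => i j; rewrite !mxE.
by rewrite mulmxN !mulNmx opprK !mulmxA mulmxV// mul1mx -mulmxA mulVmx// mulmx1.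
Qed.

Lemma norm_chain_le (R : realType) (V : normedModType R) (a b c d : V) (e : R) :
  `|a - b| <= e / 3 -> `|b - c| <= e / 3 -> `|d - c| <= e / 3 -> `|a - d| <= e.
Proof.
move=> ab bc dc; rewrite (_ : e = e / 3 + (e / 3 + e / 3)); last by field.
apply: le_trans (ler_distD b a d) _; rewrite lerD//.
by apply: le_trans (ler_distD c b d) _; rewrite lerD// distrC.
Qed.

Theorem theorem4 (R : realType) (d : measure_display) (Omega : measurableType d)
  (P : probability Omega R) (p : nat)
  (Theta : set 'rV[R]_p)
  (Q Qt : nat -> Omega -> 'rV[R]_p -> R)
  (thetaAM : nat -> Omega -> 'rV[R]_p)
  (Q0 : 'rV[R]_p -> R) (theta0 : 'rV[R]_p)
  (N : set 'rV[R]_p) (Sigma : 'M[R]_p) (H : 'rV[R]_p -> 'M[R]_p) :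
  (* hat theta_AM = argmax over Theta of tilde Q_n (a random vector) *)
  (forall n w, Theta (thetaAM n w)) ->
  (forall n w theta, Theta theta -> Qt n w theta <= Qt n w (thetaAM n w)) ->
  (forall n i, measurable_fun setT (fun w => thetaAM n w 0 i)) ->
  (* (i) *)
  Theta theta0 ->
  (forall theta, Theta theta -> theta != theta0 -> Q0 theta < Q0 theta0) ->
  compact Theta ->
  {within Theta, continuous Q0} ->
  plim0 P (fun n w => ereal_sup [set (`|Q n w theta - Q0 theta|)%:E | theta in Theta]) ->
  (Theta°) theta0 ->
  open N -> N theta0 -> N `<=` Theta ->
  (forall n w, C2_on N (Q n w)) ->
  cvg_dist_normal P (fun n w => Num.sqrt (n%:R) *: grad (Q n w) theta0) Sigma ->
  {for theta0, continuous H} ->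
  plim0 P (fun n w => ereal_sup [set (`|hess (Q n w) theta - H theta|)%:E | theta in N]) ->
  H theta0 \in unitmx ->
  (* (ii) *)
  (forall n, {ae P, forall w, C2_on N (Qt n w)}) ->
  (* (iii) *)
  plim0 P (fun n w => ereal_sup [set (`|Qt n w theta - Q n w theta|)%:E | theta in Theta]) ->
  (* (iv) *)
  plim0 P (fun n w => ((Num.sqrt (n%:R))%:E *
      ereal_sup [set (`|grad (Qt n w) theta - grad (Q n w) theta|)%:E | theta in Theta])%E) ->
  (* (v) *)
  plim0 P (fun n w =>
      ereal_sup [set (`|hess (Qt n w) theta - hess (Q n w) theta|)%:E | theta in Theta]) ->
  cvg_dist_normal P (fun n w => Num.sqrt (n%:R) *: (thetaAM n w - theta0))
    (invmx (H theta0) *m Sigma *m invmx (H theta0)).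
Proof.
move=> thT thmax mth T0 Q0max cT cQ0 QQ0 _ Nopen N0 NT QC2 [mG GS] Hc QH
  Hunit QtC2 QtQ gradQt hessQt.
have mX n i : measurable_fun setT
    (fun w => (Num.sqrt n%:R *: (thetaAM n w - theta0)) 0 i).
  rewrite [X in measurable_fun _ X](_ : _ =
      fun w => Num.sqrt n%:R * (thetaAM n w 0 i - theta0 0 i)).
    by apply: measurable_funM => //; exact: measurable_funB.
  by apply/funext => w; rewrite !mxE.
split; [exact: mX | move=> d' T' P' Z gZ].
have Hsym := limit_hess_sym R d Omega P p N Q theta0 H Nopen N0 QC2 QH.
set A := H theta0 in Hunit gZ Hsym *.
pose G n w := Num.sqrt n%:R *: grad (Q n w) theta0.
pose Y n w := G n w *m (- invmx A).
have [_ _ mZ _] := gZ.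
have mY n i : measurable_fun setT (fun w => Y n w 0 i).
  by apply: measurable_mulmxr; exact: mG.
have gZ' : is_gauss_vec P' (fun w => Z w *m (- A)) Sigma.
  have := is_gauss_vec_mulmx R d' T' P' p Z _ (- A) gZ.
  by rewrite sandwich_mulmxN.
apply: (expectation_cvg_perturb R d d' Omega T' P P' p _ Y Z mX mY mZ).
  (* The assumed convergence of the scaled gradients is tested on [f] composed with multiplication
     by [- invmx A], which sends [Z *m (- A)] back to [Z]. *)
  move=> f fc [M fM].
  have gc : continuous (fun x : 'rV[R]_p => f (x *m (- invmx A))).
    by move=> x; apply: continuous_comp; [exact: continuous_mulmxr | exact: fc].
  have gM : exists M : R, forall x, `|f (x *m (- invmx A))| <= M by exists M.
  have := GS d' T' P' _ gZ' _ gc gM.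
  suff -> : (fun w => (f (Z w *m (- A) *m (- invmx A)))%:E) = (fun w => (f (Z w))%:E) by [].
  by apply/funext => w; rewrite -mulmxA mulNmx !mulmxN opprK mulmxV// mulmx1.
move=> K eta delta K0 eta0 delta0.
set c := `|invmx A|.
(* A single tolerance [s] bounds both the scaled gradient error and the Hessian error: [small1]
   permits the absorption, [small2] makes the final bound at most [eta]. The [+ 1] in each
   denominator guards against a zero coefficient. *)
have [s s0 [small1 small2]] : exists2 s : R, 0 < s &
    p%:R * (p%:R * s * c) <= 1 / 2 /\ 2 * (p%:R * (1 + p%:R * K) * c) * s <= eta.
  have c0 : 0 <= c by exact: normr_ge0.
  have a0 : 0 <= 2 * p%:R * p%:R * c by rewrite !mulr_ge0.
  have b0 : 0 <= 2 * (p%:R * (1 + p%:R * K) * c).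
    by rewrite !mulr_ge0// addr_ge0// mulr_ge0// ltW.
  have b1 : 0 < 2 * (p%:R * (1 + p%:R * K) * c) + 1 by rewrite ltr_wpDl.
  have a1 : 0 < 2 * p%:R * p%:R * c + 1 by rewrite ltr_wpDl.
  exists (Num.min (1 / (2 * p%:R * p%:R * c + 1))
    (eta / (2 * (p%:R * (1 + p%:R * K) * c) + 1))).
    by rewrite lt_min !divr_gt0.
  set m := Num.min _ _.
  have m1 : m * (2 * p%:R * p%:R * c + 1) <= 1 by rewrite -ler_pdivlMr// ge_min lexx.
  have m2 : m * (2 * (p%:R * (1 + p%:R * K) * c) + 1) <= eta.
    by rewrite -ler_pdivlMr// ge_min lexx orbT.
  have m0 : 0 < m by rewrite lt_min !divr_gt0.
  by split; nra.
(* The distance from the Hessian of [Qt] at [z] to [A] splits in three: to the Hessian of [Q], then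
   to [H z], then to [A] by continuity of [H]. *)
have s30 : 0 < s / 3 by rewrite divr_gt0.
have /nbhs_ballP[r /= r0 rP] : \forall z \near theta0, N z /\ `|A - H z| < s / 3.
  apply: filterI; first exact: open_nbhs_nbhs.
  by have /cvgr_dist_lt := Hc; apply.
have [gap gap0 gapP] := unique_max_gap R p Theta Q0 theta0 r cT cQ0 r0 Q0max.
(* Off the exceptional sets the bounds are non-strict; [gap / 5] turns them into the strict bounds
   by [gap / 4] required for consistency. *)
have gap50 : 0 < gap / 5 by rewrite divr_gt0.
have gap54 : gap / 5 < gap / 4 by rewrite ltr_pM2l// ltf_pV2 ?posrE// ltr_nat.
(* Five exceptional sets share [delta]; the sixth, where [Qt n w] may fail to be twice continuously
   differentiable, is null. *)
have d50 : 0 < delta / 5 by rewrite divr_gt0.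
near=> n.
have [B1 [mB1 PB1 BP1]] : exists B, [/\ measurable B,
    (P B < (delta / 5)%:E)%E & forall w, ~ B w ->
    (ereal_sup [set (`|Q n w theta - Q0 theta|)%:E | theta in Theta] <= (gap / 5)%:E)%E].
  by near: n; exact: (plim0_near R d Omega P _ _ _ QQ0 gap50 d50).
have [B2 [mB2 PB2 BP2]] : exists B, [/\ measurable B,
    (P B < (delta / 5)%:E)%E & forall w, ~ B w ->
    (ereal_sup [set (`|Qt n w theta - Q n w theta|)%:E | theta in Theta] <= (gap / 5)%:E)%E].
  by near: n; exact: (plim0_near R d Omega P _ _ _ QtQ gap50 d50).
have [B3 [mB3 PB3 BP3]] : exists B, [/\ measurable B,
    (P B < (delta / 5)%:E)%E & forall w, ~ B w ->
    ((Num.sqrt n%:R)%:E * ereal_sup [set (`|grad (Qt n w) theta - grad (Q n w) theta|)%:E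
       | theta in Theta] <= s%:E)%E].
  by near: n; exact: (plim0_near R d Omega P _ _ _ gradQt s0 d50).
have [B4 [mB4 PB4 BP4]] : exists B, [/\ measurable B,
    (P B < (delta / 5)%:E)%E & forall w, ~ B w ->
    (ereal_sup [set (`|hess (Qt n w) theta - hess (Q n w) theta|)%:E
       | theta in Theta] <= (s / 3)%:E)%E].
  by near: n; exact: (plim0_near R d Omega P _ _ _ hessQt s30 d50).
have [B5 [mB5 PB5 BP5]] : exists B, [/\ measurable B,
    (P B < (delta / 5)%:E)%E & forall w, ~ B w ->
    (ereal_sup [set (`|hess (Q n w) theta - H theta|)%:E | theta in N] <= (s / 3)%:E)%E].
  by near: n; exact: (plim0_near R d Omega P _ _ _ QH s30 d50).
have [B6 [mB6 PB6 BP6]] := QtC2 n.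
exists (B1 `|` B2 `|` B3 `|` B4 `|` B5 `|` B6); split.
- by do !apply: measurableU.
- have PU (B C : set Omega) (x y : R) : measurable B -> measurable C ->
      (P B < x%:E)%E -> (P C < y%:E)%E -> (P (B `|` C) < (x + y)%:E)%E.
    move=> mB mC PB PC; apply: (le_lt_trans (measureU2 _ mB mC)).
    by rewrite EFinD lteD.
  apply: (@le_lt_trans _ _ (P (B1 `|` B2 `|` B3 `|` B4 `|` B5))).
    apply: le_trans (measureU2 _ _ _) _ => //; first by do !apply: measurableU.
    rewrite -[leRHS]adde0 leeD2l// le_eqVlt; apply/orP; left; exact/eqP.
  have -> : delta = delta / 5 + delta / 5 + delta / 5 + delta / 5 + delta / 5 by field.
  by do 4 (apply: (PU) => //; try by do !apply: measurableU).
move=> w nB YK.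
have [nB1 nB2 nB3] : [/\ ~ B1 w, ~ B2 w & ~ B3 w].
  by split => Bw; apply: nB; do ![by right | left].
have [nB4 nB5 nB6] : [/\ ~ B4 w, ~ B5 w & ~ B6 w].
  by split => Bw; apply: nB; do ![by right | left].
have {}QtC2 : C2_on N (Qt n w) by apply: contrapT => nC; apply: nB6; exact: BP6.
have thr : ball theta0 r (thetaAM n w).
  apply: (near_argmax_in_ball R p Theta Q0 (Q n w) (Qt n w) _ _ r gap) => //.
  - exact: thmax.
  - by move=> t Tt; apply: le_lt_trans gap54; exact: ereal_sup_norm_le (BP1 w nB1) Tt.
  - by move=> t Tt; apply: le_lt_trans gap54; exact: ereal_sup_norm_le (BP2 w nB2) Tt.
have -> : Num.sqrt n%:R *: (thetaAM n w - theta0) - Y n w =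
    Num.sqrt n%:R *: (thetaAM n w - theta0) +
      (Num.sqrt n%:R *: grad (Q n w) theta0) *m invmx A.
  by rewrite /Y /G mulmxN opprK.
apply: le_trans small2.
apply: (argmax_linearization R p N (Qt n w) theta0 (thetaAM n w) (grad (Q n w) theta0)
  A r _ s K) => //.
- by move=> z /rP[].
- by move=> z Nz; apply: thmax; exact: NT.
- exact: ltW.
- rewrite normrZ ger0_norm ?sqrtr_ge0// -lee_fin; apply: le_trans (BP3 w nB3).
  rewrite EFinM lee_wpmul2l ?lee_fin ?sqrtr_ge0//.
  by apply: ereal_sup_ubound; exists theta0.
- move=> z rz; have [Nz Hz] := rP z rz.
  have h4 := ereal_sup_norm_le _ _ _ _ _ _ _ (BP4 w nB4) (NT _ Nz).
  have h5 := ereal_sup_norm_le _ _ _ _ _ _ _ (BP5 w nB5) Nz.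
  exact: norm_chain_le h4 h5 (ltW Hz).
- by move: YK; rewrite /Y mulmxN normrN.
Unshelve. all: by end_near. Qed.
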